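(* Let $(R,M,k)$ be a complete local ring. Then the following statements are equivalent: (i) $R$ has a coefficient field. (ii) The natural surjective ring map $R\rightarrow k$ admits a splitting, i.e. there is a ring map $g:k\rightarrow R$ whose composition with $R\rightarrow k$ is the identity of $k$. (iii) $R$ is equi-characteristic, i.e. $\operatorname{char}(R)=\operatorname{char}(k)$. Furthermore, if $\operatorname{char}(R)\neq\operatorname{char}(k)$, then the natural surjective group homomorphism between the groups of units $R^{\ast}\rightarrow k^{\ast}$ admits a splitting, i.e. there is a group homomorphism $s:k^{\ast}\rightarrow R^{\ast}$ whose composition with $R^{\ast}\rightarrow k^{\ast}$ is the identity of $k^{\ast}$.
   Context: All rings are commutative with $1$ and ring maps preserve $1$. A local ring $(R,M,k)$ is a ring $R$ with a unique maximal ideal $M$ and residue field $k=R/M$. It is called complete if the natural ring map $R\rightarrow\varprojlim_{n\geqslant1}R/M^{n}$, $r\mapsto(r+M^{n})_{n\geqslant1}$, is an isomorphism; $R$ is not assumed to be Noetherian. $R^{\ast}$ denotes the group of units of $R$, and $\operatorname{char}(R)$ is the non-negative generator of the kernel of $\mathbb{Z}\rightarrow R$. A local ring $(R,M,k)$ has a coefficient field if there are a field $K$ and a ring map $K\rightarrow R$ whose composition with the natural map $R\rightarrow k$ is an isomorphism $K\rightarrow k$. *)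

(* Defs.v *)
From HB Require Import structures.
From mathcomp Require Import all_boot all_order all_algebra.
From mathcomp Require Import boolp classical_sets.

Set Implicit Arguments.
Unset Strict Implicit.
Unset Printing Implicit Defensive.

Import GRing.Theory.
Local Open Scope ring_scope.
Local Open Scope quotient_scope.

(* [pchar R] only records prime characteristics, whereas a local ring can have
   characteristic p ^ n; c generates the kernel of Z -> R. *)
Definition is_ring_char (R : nzRingType) (c : nat) : Prop :=
  forall z : int, z%:~R = 0 :> R <-> (c%:Z %| z)%Z.

(* The default value 0 is never used, by ring_charP. *)
Definition ring_char (R : nzRingType) : nat := xget 0%N (@is_ring_char R).

Lemma ring_charP (R : nzRingType) : is_ring_char R (ring_char R).
Proof.
have natP c : (forall n, (n%:R == 0 :> R) = (c %| n)%N) -> is_ring_char R c.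
  move=> h z; rewrite dvdzE absz_nat -h.
  case: z => n; first by rewrite absz_nat -pmulrn; split=> /eqP.
  rewrite NegzE abszN absz_nat mulrNz -pmulrn; split=> [/eqP|/eqP->].
    by rewrite oppr_eq0.
  by rewrite oppr0.
suff [c hc] : exists c, is_ring_char R c.
  exact: (xgetPex 0%N (ex_intro _ c hc)).
have [ex|no] := pselect (exists m, (0 < m)%N && (m%:R == 0 :> R)).
  case: (ex_minnP ex) => c /andP[c0 /eqP cR] cmin; exists c; apply: natP => n.
  rewrite {1}(divn_eq n c) natrD natrM cR mulr0 add0r /dvdn.
  apply/idP/idP => [nR|/eqP->//]; apply: contraT; rewrite -lt0n => r0.
  have := cmin (n %% c)%N; rewrite r0 nR => /(_ isT).
  by rewrite leqNgt ltn_pmod.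
exists 0%N; apply: natP => n; rewrite dvd0n; apply/idP/idP => [nR|/eqP->//].
apply: contraT; rewrite -lt0n => n0.
by case: no; exists n; rewrite n0 nR.
Qed.

Lemma ring_char_unique (R : nzRingType) (c : nat) :
  is_ring_char R c -> c = ring_char R.
Proof.
move=> hc; have hR := ring_charP R; apply/eqP; rewrite eqn_dvd.
apply/andP; split; first exact/(hc (ring_char R))/hR/dvdzz.
exact/(hR c)/hc/dvdzz.
Qed.

(* {unit R} is only available for finite rings. *)
Definition unit_group (R : unitRingType) : Type := {x : R | x \is a GRing.unit}.

Section UnitGroup.
Variable R : unitRingType.

HB.instance Definition _ := SubChoice.on (unit_group R).

Implicit Types x y z : unit_group R.

Definition unit_group_one : unit_group R := Sub 1 (unitr1 R).
Definition unit_group_mul x y : unit_group R :=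
  Sub (val x * val y) (etrans (unitrMl _ (valP y)) (valP x)).
Definition unit_group_inv x : unit_group R :=
  Sub (val x)^-1 (etrans (unitrV _) (valP x)).

Fact unit_group_mulA : associative unit_group_mul.
Proof. by move=> x y z; apply: val_inj; rewrite /= mulrA. Qed.
Fact unit_group_mul1g : left_id unit_group_one unit_group_mul.
Proof. by move=> x; apply: val_inj; rewrite /= mul1r. Qed.
Fact unit_group_mulg1 : right_id unit_group_one unit_group_mul.
Proof. by move=> x; apply: val_inj; rewrite /= mulr1. Qed.
Fact unit_group_mulVg :
  left_inverse unit_group_one unit_group_inv unit_group_mul.
Proof. by move=> x; apply: val_inj; rewrite /= mulVr ?(valP x). Qed.
Fact unit_group_mulgV :
  right_inverse unit_group_one unit_group_inv unit_group_mul.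
Proof. by move=> x; apply: val_inj; rewrite /= mulrV ?(valP x). Qed.

HB.instance Definition _ := isGroup.Build (unit_group R)
  unit_group_mulA unit_group_mul1g unit_group_mulg1
  unit_group_mulVg unit_group_mulgV.

End UnitGroup.

Definition unit_group_map (R S : unitRingType) (f : {rmorphism R -> S})
    (x : unit_group R) : unit_group S :=
  Sub (f (val x)) (rmorph_unit f (valP x)).

Fact unit_group_map_is_group_morphism (R S : unitRingType)
    (f : {rmorphism R -> S}) :
  {morph unit_group_map f : x y / (x / y)%g}.
Proof. by move=> x y; apply: val_inj; rewrite /= rmorphM rmorphV ?(valP y). Qed.

HB.instance Definition _ (R S : unitRingType) (f : {rmorphism R -> S}) :=
  isGroupMorphism.Build _ _ (unit_group_map f)
    (unit_group_map_is_group_morphism f).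

(* An [idealr] is proper by definition. *)
HB.mixin Record isMaximalIdealr (R : nzRingType) (M : R -> bool)
    of Idealr R M := {
  maximal_idealr_subproof :
    forall I : idealr R, {subset M <= I} -> {subset I <= M}
}.

#[short(type="maximal_idealr")]
HB.structure Definition MaximalIdealr (R : nzRingType) :=
  {M of isMaximalIdealr R M & Idealr R M}.

Definition local_ring (R : nzRingType) (M : maximal_idealr R) : Prop :=
  forall M' : maximal_idealr R, M' =i M.

Definition residue_field (R : comNzRingType) (M : maximal_idealr R) : Type :=
  {ideal_quot M}.

Section ResidueField.
Variables (R : comNzRingType) (M : maximal_idealr R).
Local Notation k := (residue_field M).

HB.instance Definition _ := GRing.ComNzRing.on k.

Definition residue_map : R -> k := \pi_{ideal_quot M}.

HB.instance Definition _ := GRing.RMorphism.on residue_map.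

Definition residue_inv (x : k) : k := xget 0 [set y | y * x = 1].

Fact residue_mulVf : forall x : k, x != 0 -> residue_inv x * x = 1.
Proof.
move=> x x0.
suff [y hy] : exists y : k, y * x = 1.
  exact: (@xgetPex _ 0 [set y | y * x = 1] (ex_intro _ y hy)).
rewrite -[x](@reprK _ {ideal_quot M}); set a := repr x.
have aM : a \notin M.
  apply: contra x0; rewrite -[a]subr0 Quotient.idealrBE reprK => /eqP ->.
  by rewrite -[X in _ == X]pi_zeror.
pose I : R -> bool := fun z => `[< exists m b, m \in M /\ z = m + b * a >].
have [/asboolP[m [b [mM e]]]|I1] := boolP (1 \in I).
  exists (residue_map b); rewrite -[\pi a]/(residue_map a) -rmorphM.
  have -> : b * a = 1 - m by rewrite e [m + _]addrC addrK.
  have m0 : residue_map m = 0.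
    rewrite -[RHS](rmorph0 residue_map); apply/eqP.
    rewrite -[_ == _]/(\pi_{ideal_quot M} m == \pi_{ideal_quot M} 0).
    by rewrite -Quotient.idealrBE subr0.
  by rewrite rmorphB rmorph1 /= m0 subr0.
have Icl : idealr_closed I.
  split=> //; first by apply/asboolP; exists 0, 0; rewrite rpred0 mul0r addr0.
  move=> c u v /asboolP[m [b [mM ->]]] /asboolP[m' [b' [mM' ->]]].
  apply/asboolP; exists (c * m + m'), (c * b + b'); split.
    by rewrite rpredD ?idealMr.
  by rewrite mulrDr mulrDl mulrA addrACA.
pose HI := isIdealr.Build R I Icl.
pose J : idealr R := HB.pack I HI.
case/negP: aM; apply: (maximal_idealr_subproof (s := M) J).
  by move=> z zM; apply/asboolP; exists z, 0; rewrite mul0r addr0.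
by apply/asboolP; exists 0, 1; rewrite rpred0 mul1r add0r.
Qed.

Fact residue_inv0 : residue_inv 0 = 0.
Proof.
by apply: xgetPN => y /= /eqP; rewrite mulr0 eq_sym oner_eq0.
Qed.

HB.instance Definition _ :=
  GRing.ComNzRing_isField.Build k residue_mulVf residue_inv0.

End ResidueField.

Definition ideal_mul (R : nzRingType) (I J : {pred R}) : {pred R} :=
  [pred x | `[< exists s : seq (R * R),
    {in s, forall u, u.1 \in I /\ u.2 \in J} /\
    x = \sum_(u <- s) u.1 * u.2 >]].

(* The (n + 1)-st power of M; the power M ^ 0 = R is not an [idealr]. *)
Fixpoint ideal_powS (R : nzRingType) (M : {pred R}) (n : nat) : {pred R} :=
  if n is n'.+1 then ideal_mul M (ideal_powS M n') else M.

Section AdicCompletion.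
Variables (R : comNzRingType) (M : idealr R).

Fact ideal_mulSl (J : {pred R}) : {subset ideal_mul M J <= M}.
Proof.
move=> x /asboolP[s [sP ->]]; rewrite big_seq; apply: rpred_sum => u /sP[uM _].
by rewrite mulrC idealMr.
Qed.

Fact ideal_powS_closed n : idealr_closed (ideal_powS M n).
Proof.
case: n => [|n].
  by split=> [||a u v *]; rewrite ?idealr1 ?rpred0 ?rpredD ?idealMr.
split=> [||a _ _ /asboolP[s [sP ->]] /asboolP[t [tP ->]]].
- by apply/asboolP; exists [::]; split=> //; rewrite big_nil.
- by apply/negP => /ideal_mulSl; rewrite idealr1.
apply/asboolP; exists ([seq (a * u.1, u.2) | u <- s] ++ t); split.
  move=> u; rewrite mem_cat => /orP[/mapP[w /sP[w1 w2] ->]|/tP//].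
  by rewrite /= idealMr.
rewrite big_cat big_map /= mulr_sumr; congr (_ + _).
by apply: eq_bigr => u _; rewrite mulrA.
Qed.

HB.instance Definition _ n := isIdealr.Build R (ideal_powS M n)
  (ideal_powS_closed n).

Fact ideal_powSS n : {subset ideal_powS M n.+1 <= ideal_powS M n}.
Proof.
elim: n => [|n IHn]; first exact: ideal_mulSl.
move=> x /asboolP[s [sP ->]]; apply/asboolP; exists s; split=> // u /sP[u1 u2].
by split=> //; apply: IHn.
Qed.

Definition adic_quot n : Type := {ideal_quot (ideal_powS M n)}.
HB.instance Definition _ n := GRing.ComNzRing.on (adic_quot n).

Definition adic_proj n : R -> adic_quot n := \pi_{ideal_quot (ideal_powS M n)}.
HB.instance Definition _ n := GRing.RMorphism.on (adic_proj n).

Definition adic_transition n (x : adic_quot n.+1) : adic_quot n :=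
  adic_proj n (repr (x : {ideal_quot (ideal_powS M n.+1)})).

Lemma adic_transitionE n (r : R) :
  adic_transition (adic_proj n.+1 r) = adic_proj n r.
Proof.
apply/eqP; rewrite -[_ == _]/(_ == _ %[mod {ideal_quot (ideal_powS M n)}]).
rewrite -Quotient.idealrBE; apply: ideal_powSS.
by rewrite Quotient.idealrBE reprK.
Qed.

Definition adic_compatible (x : forall n, adic_quot n) : Prop :=
  forall n, adic_transition (x n.+1) = x n.

Definition adic_limit : Type := {x : forall n, adic_quot n | adic_compatible x}.

Definition to_adic_limit (r : R) : adic_limit :=
  exist adic_compatible (fun n => adic_proj n r)
    (fun n => adic_transitionE n r).

(* The ring structure of the limit is componentwise, so that to_adic_limit is a
   ring isomorphism exactly when it is bijective. *)
Definition adically_complete : Prop := bijective to_adic_limit.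

End AdicCompletion.

Definition has_coefficient_field (R : comNzRingType) (M : maximal_idealr R) :
    Prop :=
  exists (K : fieldType) (f : {rmorphism K -> R}),
    bijective (@residue_map R M \o f).

(* Main.v *)
Require Import Defs.
From HB Require Import structures.
From mathcomp Require Import all_boot all_order all_algebra.
From mathcomp Require Import boolp classical_sets ring.

Set Implicit Arguments.
Unset Strict Implicit.
Unset Printing Implicit Defensive.

Import GRing.Theory.
Local Open Scope classical_set_scope.
Local Open Scope ring_scope.

(** Write k for the residue field.  A coefficient field is the same as a
    splitting of R -> k, and a ring map k -> R forces the characteristics to
    agree; the work is to split R -> k.  As R is complete, it is enough to lift
    the identity of k step by step along the maps
    R / M ^ (n + 2) -> R / M ^ (n + 1), whose kernels have square zero
    ([lift_through_adic_tower]).  So everything reduces to one square-zero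
    step: given a surjection pi : A -> B with square-zero kernel N and a map
    g : k -> B, find f : k -> A with pi \o f = g.

    For ring maps ([ring_lift_sqzero], used when char R = char k), pass to the
    fibre product C of A and k over B; then sigma : C -> k is a surjection
    onto a field with square-zero kernel and a section is wanted
    ([sqzero_section]).  By Zorn there is a maximal subring S of C which meets
    the kernel trivially and contains all p-th powers when char k = p > 0.
    Such p-th powers are harmless: if p = 0 in C, then c ^ p depends only on
    sigma c.  Maximality makes S a field.  Given x in k, let m be a polynomial
    of least degree over S having x as a root (if there is one).  If m' does
    not vanish at x, one Newton step gives an exact root of m above x.
    Otherwise m' = 0, so that char k = p and m is a polynomial in 'X^p; then
    the value of m at any lift w of x lies in S, as w ^ p does, and is 0
    because it lies in the kernel.  In all cases S[w] still meets the kernel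
    trivially, hence w is in S by maximality.

    For multiplicative maps ([multiplicative_lift_sqzero], used when
    char R != char k), the characteristic p of k is positive and p lies in M,
    so p N = 0.  This again makes a ^ p depend on pi a only, and the same
    argument with monoids instead of rings works: a maximal multiplicative
    partial lift G contains all p-th powers, and if x is outside its domain,
    then x ^ d lies in the domain only when p divides d, so that any lift of x
    may be adjoined to G. *)

(** * Maximal elements above a given one *)

(** [Zorn_bigcup] asks for the union of the empty chain too, and the empty set
    is never a subring; the disjunction with [set0] in the proof deals with
    that. *)
Lemma Zorn_above (T : Type) (P : set (set T)) (G0 : set T) : P G0 ->
    (forall F, F !=set0 -> F `<=` P -> total_on F subset ->
       P (\bigcup_(X in F) X)) ->
  exists G, P G /\ forall H, P H -> G `<=` H -> H `<=` G.
Proof.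
move=> PG0 Pchain.
have [|G [[GE|PG] Gmax]] := @Zorn_bigcup T [set G | G = set0 \/ P G].
- move=> F FP Ftot; pose F' := F `&` P.
  have [F'0|F'0] := pselect (F' !=set0); [right|left].
    suff -> : \bigcup_(X in F) X = \bigcup_(X in F') X.
      by apply: Pchain => // [X []//|X Y [FX _] [FY _]]; apply: Ftot.
    apply/seteqP; split=> t [X]; last by move=> [FX _] Xt; exists X.
    move=> FX Xt; exists X => //; split=> //.
    by case: (FP X FX) => // XE; move: Xt; rewrite XE.
  rewrite -subset0 => t [X FX Xt]; case: (FP X FX) => [XE|PX].
    by rewrite -XE.
  by case: F'0; exists X.
- exists G0; split=> // H PH _; apply: contrapT => HG0.
  apply: (Gmax H); last by right.
  by rewrite GE; split=> [t//|H0]; apply: HG0 => t /H0.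
- exists G; split=> // H PH GH; apply: contrapT => HG.
  by apply: (Gmax H); [split | right].
Qed.

Lemma chain_bigcup2 (T : Type) (F : set (set T)) (u v : T) :
    total_on F subset -> (\bigcup_(X in F) X) u -> (\bigcup_(X in F) X) v ->
  exists X, [/\ F X, X u & X v].
Proof.
move=> Ftot [X FX Xu] [Y FY Yv]; case: (Ftot X Y FX FY) => XY.
  by exists Y; split=> //; apply: XY.
by exists X; split=> //; apply: XY.
Qed.

(** * Sections of a square-zero extension of a field *)

Lemma horner_add_sqzero (C : comNzRingType) (P : {poly C}) (w h : C) :
  h * h = 0 -> P.[w + h] = P.[w] + P^`().[w] * h.
Proof.
move=> hh; elim/poly_ind: P => [|P c IH].
  by rewrite deriv0 !horner0 mul0r addr0.
rewrite derivMXaddC !hornerE IH -[LHS]subr0 -[X in _ - X](mulr0 P^`().[w]) -hh.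
ring.
Qed.

(** The reason why p-th powers lift canonically: a ^ p - b ^ p is a - b times
    a sum of p products which all agree with b ^ (p - 1) modulo the kernel, and
    the kernel is killed by p and by itself. *)
Lemma sqzero_expp (A B : comNzRingType) (pi : {rmorphism A -> B}) (p : nat) :
    (forall a b, pi a = 0 -> pi b = 0 -> a * b = 0) ->
    (forall a, pi a = 0 -> p%:R * a = 0) ->
  forall a b, pi a = pi b -> a ^+ p = b ^+ p.
Proof.
move=> sqz pN a b ab; apply/eqP; rewrite -subr_eq0 subrXX.
have N0 : pi (a - b) = 0 by rewrite rmorphB ab subrr.
have abX i : (a - b) * a ^+ i = (a - b) * b ^+ i.
  apply/eqP; rewrite -subr_eq0 -mulrBr subrXX.
  by rewrite mulrA (sqz (a - b) (a - b)) ?mul0r.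
rewrite mulr_sumr (eq_bigr (fun=> (a - b) * b ^+ p.-1)) => [|i _].
  by rewrite sumr_const card_ord -mulr_natl mulrA pN // mul0r.
rewrite mulrA abX -mulrA -exprD; congr (_ * _ ^+ _).
by rewrite subnK // -ltnS prednK // (leq_ltn_trans _ (ltn_ord i)).
Qed.

Section SquareZeroSection.

Variables (k : fieldType) (C : comNzRingType) (sigma : {rmorphism C -> k}).
Hypothesis sigma_surj : forall x, exists a, sigma a = x.
Hypothesis sigma_sqz : forall a b, sigma a = 0 -> sigma b = 0 -> a * b = 0.

Lemma sqzero_unit a : sigma a != 0 -> exists b, a * b = 1.
Proof.
move=> a0; have [b sb] := sigma_surj (sigma a)^-1.
have N0 : sigma (a * b - 1) = 0.
  by rewrite rmorphB rmorphM rmorph1 /= sb divff ?subrr.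
have e : (a * b - 1) * (a * b - 1) = 0 by apply: sigma_sqz.
exists (b * (1 - (a * b - 1))); rewrite -[RHS]subr0 -e; ring.
Qed.

(** S is a subring that sigma embeds as a subfield of k, and P a relation
    satisfied by the image of w; the relations have coefficients in S, and one
    of least degree, made monic, plays the role of the minimal polynomial. *)
Lemma subfield_monic_relation (S : subringClosed C) (w : C) (P : {poly C}) :
    (forall u, u \in S -> sigma u = 0 -> u = 0) ->
    (forall u, u \in S -> sigma u != 0 -> exists2 v, v \in S & u * v = 1) ->
    P \is a polyOver S -> P != 0 -> sigma P.[w] = 0 ->
  exists m : {poly C}, [/\ m \is monic, m \is a polyOver S, sigma m.[w] = 0 &
    forall Q, Q \is a polyOver S -> Q != 0 -> sigma Q.[w] = 0 ->
      (size m <= size Q)%N].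
Proof.
move=> Sinj Sinv PS P0 Pw.
pose rel (Q : {poly C}) :=
  [/\ Q \is a polyOver S, Q != 0 & sigma Q.[w] = 0].
have ex : exists n, `[< exists2 Q, rel Q & size Q = n >].
  by exists (size P); apply/asboolP; exists P.
case: (ex_minnP ex) => n /asboolP[Q [QS Q0 Qw] Qn] nmin.
have lS : lead_coef Q \in S by apply: (polyOverP QS).
have [|v vS vl] := Sinv _ lS.
  by apply: contra Q0 => /eqP /(Sinj _ lS) /eqP; rewrite lead_coef_eq0.
have vQ : (v *: Q)`_(size Q).-1 = 1 by rewrite coefZ mulrC vl.
have sz : size (v *: Q) = size Q.
  apply/eqP; rewrite eqn_leq size_scale_leq /= -(@prednK (size Q)).
    by rewrite ltnNge; apply/negP => /leq_sizeP /(_ _ (leqnn _)) /eqP;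
       rewrite vQ oner_eq0.
  by rewrite size_poly_gt0.
exists (v *: Q); split.
- by apply/monicP; rewrite lead_coefE sz.
- by rewrite polyOverZ.
- by rewrite hornerZ rmorphM /= Qw mulr0.
- move=> Q' Q'S Q'0 Q'w; rewrite sz Qn; apply: nmin.
  by apply/asboolP; exists Q'.
Qed.

(** Euclidean division by m, one leading term at a time: a nonzero relation is
    never shorter than m, so the last remainder is 0. *)
Lemma subfield_relation_eq0 (S : subringClosed C) (w : C) (m : {poly C}) :
    m \is monic -> m \is a polyOver S -> m.[w] = 0 ->
    (forall Q, Q \is a polyOver S -> Q != 0 -> sigma Q.[w] = 0 ->
      (size m <= size Q)%N) ->
  forall P, P \is a polyOver S -> sigma P.[w] = 0 -> P.[w] = 0.
Proof.
move=> mm mS mw mmin P; have [n] := ubnP (size P).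
elim: n P => // n IH P Pn PS Pw.
have [->|P0] := eqVneq P 0; first by rewrite horner0.
have mP := mmin P PS P0 Pw.
pose Q := P - lead_coef P *: ('X^(size P - size m) * m).
have Qw : Q.[w] = P.[w].
  by rewrite /Q hornerD hornerN hornerZ hornerM mw !mulr0 subr0.
have m0 : (0 < size m)%N by rewrite size_poly_gt0 monic_neq0.
have sQ : (size Q <= (size P).-1)%N.
  apply/leq_sizeP => j; rewrite leq_eqVlt => /orP[/eqP<-|Pj].
    rewrite coefB coefZ coefXnM; case: ltnP => [|_].
      by rewrite ltnNge -subn1 leq_sub2l.
    rewrite -subn1 subnAC subKn // !subn1 -[m`__]lead_coefE.
    by rewrite (monicP mm) mulr1 subrr.
  have Pj' : (size P <= j)%N by rewrite -[size P]prednK ?size_poly_gt0.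
  rewrite coefB coefZ coefXnM [P`_j]nth_default // sub0r.
  case: ltnP => _; rewrite ?mulr0 ?oppr0 // [m`__]nth_default ?mulr0 ?oppr0 //.
  by rewrite leq_subRL ?(leq_trans (leq_subr _ _)) // subnK.
rewrite -Qw; apply: IH; last by rewrite Qw.
  by rewrite -ltnS (leq_trans _ Pn) // ltnS (leq_ltn_trans sQ) // prednK
    ?size_poly_gt0.
rewrite rpredB // polyOverZ ?rpredM ?polyOverXn //.
exact: (polyOverP PS).
Qed.

(** The heart of the matter: any x in k has a lift w for which S[w] still embeds
    in k.  A transcendental x needs no care; an algebraic one needs a lift that
    is a root of its minimal polynomial m.  A Newton step provides it when
    m' does not vanish at x; when it does, m' = 0 by minimality, so m is a
    polynomial in 'X^p, and the p-th powers in S do the rest. *)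
Lemma subfield_adjoin (S : subringClosed C) (x : k) :
    (forall u, u \in S -> sigma u = 0 -> u = 0) ->
    (forall u, u \in S -> sigma u != 0 -> exists2 v, v \in S & u * v = 1) ->
    (forall p, p \in [pchar k] -> forall w, w ^+ p \in S) ->
  exists2 w, sigma w = x &
    forall P, P \is a polyOver S -> sigma P.[w] = 0 -> P.[w] = 0.
Proof.
move=> Sinj Sinv Sfrob; have [w0 w0x] := sigma_surj x.
have [[P [PS P0 Pw]]|noP] := pselect (exists P : {poly C},
    [/\ P \is a polyOver S, P != 0 & sigma P.[w0] = 0]); last first.
  exists w0 => // P PS Pw; have [->|P0] := eqVneq P 0; first exact: horner0.
  by case: noP; exists P.
have [m [mm mS mw mmin]] := subfield_monic_relation Sinj Sinv PS P0 Pw.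
have sigma_horner w : sigma w = x ->
    forall P : {poly C}, sigma P.[w] = sigma P.[w0].
  by move=> wx Q; rewrite -!horner_map /= wx w0x.
suff [w wx mw0] : exists2 w, sigma w = x & m.[w] = 0.
  exists w => //; apply: (subfield_relation_eq0 mm mS mw0) => Q QS Q0.
  by rewrite sigma_horner //; apply: mmin.
(* Newton step, exact because the square of the correction is 0. *)
have [dw|dw] := eqVneq (sigma m^`().[w0]) 0; last first.
  have [v dv] := sqzero_unit dw; pose h := - (m.[w0] * v).
  have h0 : sigma h = 0 by rewrite rmorphN rmorphM /= mw mul0r oppr0.
  exists (w0 + h); first by rewrite rmorphD /= h0 addr0.
  rewrite horner_add_sqzero ?(sigma_sqz h0 h0) //.
  by rewrite mulrN mulrCA dv mulr1 subrr.
(* Inseparable case: it is enough that m.[w0] lies in S. *)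
exists w0 => //; apply: (Sinj); last by [].
have d0 : m^`() = 0.
  apply: contraTeq (lt_size_deriv (monic_neq0 mm)) => d0.
  by rewrite -leqNgt mmin // polyOver_deriv.
have m1 : (1 < size m)%N.
  rewrite ltnNge; apply/negP => /size1_polyC mE.
  have m0 : m`_0 = 1 by rewrite -[LHS]lead_coefC -mE; apply: monicP.
  move: mw; rewrite mE hornerC m0 rmorph1 => /eqP.
  by rewrite (negPf (oner_neq0 k)).
have dcoef i : (0 < i)%N -> i%:R * m`_i = 0.
  case: i => // i _; rewrite mulr_natl -coef_deriv d0 coef0 //.
have [p pk] : exists p, p \in [pchar k].
  have m2 : (0 < (size m).-1)%N by rewrite -subn1 subn_gt0.
  apply: (GRing.natf0_pchar m2); move: (dcoef _ m2).
  rewrite -lead_coefE (monicP mm) mulr1 => /(congr1 sigma).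
  by rewrite rmorph_nat rmorph0 => /eqP.
rewrite horner_coef rpred_sum // => i _.
have miS : m`_i \in S by apply: (polyOverP mS).
have [pi|pNi] := boolP (p %| i)%N.
  rewrite -[X in _ ^+ X](divnK pi) mulnC exprM rpredM //.
  exact/rpredX/(Sfrob p pk).
suff -> : m`_i = 0 by rewrite mul0r rpred0.
have i0 : (0 < i)%N.
  by rewrite lt0n; apply: contraNneq pNi => ->; rewrite dvdn0.
apply: Sinj => //; move/(congr1 sigma): (dcoef _ i0).
rewrite rmorphM rmorph_nat rmorph0 => /eqP.
by rewrite mulf_eq0 -(dvdn_pcharf pk) (negPf pNi) => /eqP.
Qed.


Hypothesis char_C : forall p, p \in [pchar k] -> p%:R = 0 :> C.

(** A ring map from a subring of k to C that splits sigma is the same as its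
    image G, on which sigma is injective.  Asking for the p-th powers from the
    start is what makes inseparable elements of k liftable later. *)
Definition ring_partial_section (G : set C) : Prop :=
  [/\ subring_closed [pred u | `[< G u >]],
      forall u, G u -> sigma u = 0 -> u = 0 &
      forall p, p \in [pchar k] -> forall w, G (w ^+ p)].

Lemma ring_partial_section_bigcup (F : set (set C)) :
  F !=set0 -> F `<=` ring_partial_section -> total_on F subset ->
  ring_partial_section (\bigcup_(X in F) X).
Proof.
move=> [X0 FX0] FP Ftot.
split=> [|u [X FX Xu]|p pk w]; last 2 first.
- by case: (FP X FX) => _ XI _; apply: XI.
- by exists X0 => //; case: (FP X0 FX0) => _ _ XF; apply: XF.
split=> [|u v|u v].
- apply/asboolP; exists X0 => //; case: (FP X0 FX0) => -[X1 _ _] _ _.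
  exact/asboolP.
- move=> /asboolP Uu /asboolP Uv.
  have [X [FX Xu Xv]] := chain_bigcup2 Ftot Uu Uv.
  apply/asboolP; exists X => //; case: (FP X FX) => -[_ XB _] _ _.
  by apply/asboolP; apply: XB; apply/asboolP.
- move=> /asboolP Uu /asboolP Uv.
  have [X [FX Xu Xv]] := chain_bigcup2 Ftot Uu Uv.
  apply/asboolP; exists X => //; case: (FP X FX) => -[_ _ XM] _ _.
  by apply/asboolP; apply: XM; apply/asboolP.
Qed.

(** In characteristic 0 start from the image of Z, in characteristic p from the
    ring of p-th powers. *)
Lemma ring_partial_section_exists : exists G, ring_partial_section G.
Proof.
have [[p pk]|k0] := pselect (exists p, p \in [pchar k]); last first.
  exists [set u | exists z : int, u = z%:~R]; split; last 2 first.
  - move=> _ [z ->]; rewrite rmorph_int => /eqP.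
    case: z => n; rewrite ?NegzE ?mulrNz ?oppr_eq0 -pmulrn => n0.
      case: n n0 => [|n] n0 //; case: k0.
      by apply: (GRing.natf0_pchar (ltn0Sn n)).
    by case: k0; apply: (GRing.natf0_pchar (ltn0Sn n)).
  - by move=> p pk; case: k0; exists p.
  split=> [|u v|u v].
  - by apply/asboolP; exists 1.
  - move=> /asboolP[z ->] /asboolP[z' ->]; apply/asboolP; exists (z - z').
    by rewrite intrB.
  - move=> /asboolP[z ->] /asboolP[z' ->]; apply/asboolP; exists (z * z').
    by rewrite intrM.
have pC : p \in [pchar C].
  by rewrite inE (char_C pk) eqxx andbT; move: pk => /andP[].
exists [set u | exists w, u = w ^+ p]; split; last 2 first.
- move=> _ [w ->]; rewrite rmorphXn => /eqP.
  rewrite expf_eq0 => /andP[_ /eqP w0].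
  rewrite (@sqzero_expp _ _ sigma p sigma_sqz _ w 0) ?rmorph0 //.
    by rewrite expr0n; case: p pk {pC} => // /andP[].
  by move=> a _; rewrite (char_C pk) mul0r.
- move=> q qk w; exists w.
  by move: (qk); rewrite (pcharf_eq pk) inE => /eqP ->.
split=> [|u v|u v].
- by apply/asboolP; exists 1; rewrite expr1n.
- move=> /asboolP[z ->] /asboolP[z' ->]; apply/asboolP; exists (z - z').
  by rewrite -!(pFrobenius_autE pC) rmorphB.
- move=> /asboolP[z ->] /asboolP[z' ->]; apply/asboolP; exists (z * z').
  by rewrite exprMn.
Qed.

(** A maximal partial section is closed under division, since localizing it at
    its nonzero elements gives a partial section, and its domain is all of k
    by [subfield_adjoin]. *)
Lemma sqzero_section : exists s : k -> C,
  [/\ zmod_morphism s, GRing.monoid_morphism s & cancel s sigma].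
Proof.
have [G0 PG0] := ring_partial_section_exists.
have [G [[Gring Ginj Gfrob] Gmax]] :=
  Zorn_above PG0 ring_partial_section_bigcup.
pose inG u : bool := `[< G u >].
pose S : subringClosed C :=
  HB.pack inG (GRing.isSubringClosed.Build C inG Gring).
have SE u : (u \in S) = `[< G u >] by [].
have Sinj u : u \in S -> sigma u = 0 -> u = 0.
  by rewrite SE => /asboolP; apply: Ginj.
have Sfrob p : p \in [pchar k] -> forall w, w ^+ p \in S.
  by move=> pk w; rewrite SE; apply/asboolP/Gfrob.
have Sinv u : u \in S -> sigma u != 0 -> exists2 v, v \in S & u * v = 1.
  (* H is the localization of G: the fractions with denominator in G. *)
  pose H := [set u | exists v, [/\ v \in S, sigma v != 0 & u * v \in S]].
  have GH : G `<=` H.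
    move=> w Gw; exists 1; rewrite rpred1 rmorph1 oner_neq0 mulr1 SE.
    by split=> //; apply/asboolP.
  move=> uS u0; have [v uv] := sqzero_unit u0; exists v => //.
  rewrite SE; apply/asboolP; apply: (Gmax H) => //; last first.
    by exists u; rewrite uS u0 mulrC uv rpred1.
  split; last 2 first.
  - move=> a [b [bS b0 abS]] a0; have [c bc] := sqzero_unit b0.
    by rewrite -[a]mulr1 -bc mulrA (Sinj (a * b)) ?mul0r // rmorphM /= a0 mul0r.
  - by move=> p pk w; apply: GH; apply: Gfrob.
  split=> [|a b|a b].
  - by apply/asboolP; apply: GH; apply/asboolP; rewrite -SE rpred1.
  - move=> /asboolP[c [cS c0 acS]] /asboolP[d [dS d0 bdS]]; apply/asboolP.
    exists (c * d); rewrite rmorphM mulf_neq0 // rpredM //; split=> //.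
    have -> : (a - b) * (c * d) = (a * c) * d - (b * d) * c by ring.
    by rewrite rpredB // rpredM.
  - move=> /asboolP[c [cS c0 acS]] /asboolP[d [dS d0 bdS]]; apply/asboolP.
    exists (c * d); rewrite rmorphM mulf_neq0 // rpredM //; split=> //.
    by rewrite mulrACA rpredM.
have Sdom x : exists u, u \in S /\ sigma u = x.
  have [w wx wrel] := subfield_adjoin x Sinj Sinv Sfrob.
  pose H := [set u | exists2 P : {poly C}, P \is a polyOver S & u = P.[w]].
  have GH : G `<=` H.
    move=> u Gu; exists u%:P; rewrite ?hornerC //.
    by rewrite polyOverC SE; apply/asboolP.
  exists w; split=> //; rewrite SE; apply/asboolP; apply: (Gmax H) => //.
    split; last 2 first.
    - by move=> _ [P PS ->]; apply: wrel.
    - by move=> p pk u; apply: GH; apply: Gfrob.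
    split=> [|a b|a b].
    - by apply/asboolP; exists 1; rewrite ?rpred1 ?hornerC.
    - move=> /asboolP[P PS ->] /asboolP[Q QS ->]; apply/asboolP.
      by exists (P - Q); rewrite ?rpredB // hornerD hornerN.
    - move=> /asboolP[P PS ->] /asboolP[Q QS ->]; apply/asboolP.
      by exists (P * Q); rewrite ?rpredM // hornerM.
  by exists 'X; rewrite ?polyOverX ?hornerX.
have [s sP] := choice Sdom.
have sS x : s x \in S by case: (sP x).
have sK x : sigma (s x) = x by case: (sP x).
have Suniq u v : u \in S -> v \in S -> sigma u = sigma v -> u = v.
  move=> uS vS uv; apply/eqP; rewrite -subr_eq0; apply/eqP.
  by apply: Sinj; rewrite ?rpredB // rmorphB uv subrr.
exists s; split=> [x y||//].
  by apply: Suniq; rewrite ?rpredB // rmorphB !sK.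
by split=> [|x y]; apply: Suniq;
  rewrite ?rpred1 ?rpredM ?rmorph1 ?rmorphM //= !sK.
Qed.

End SquareZeroSection.

(** * Lifting ring maps along a square-zero extension *)

Section FibreProduct.

Variables (k A B : comNzRingType).
Variables (pi : {rmorphism A -> B}) (g : {rmorphism k -> B}).

Definition in_fibre_product (w : k * A) : bool := pi w.2 == g w.1.

Fact in_fibre_product_subring : subring_closed in_fibre_product.
Proof.
split=> [|u v /eqP eu /eqP ev|u v /eqP eu /eqP ev]; apply/eqP => /=.
- by rewrite !rmorph1.
- by rewrite !rmorphB eu ev.
- by rewrite !rmorphM eu ev.
Qed.

HB.instance Definition _ :=
  GRing.isSubringClosed.Build (k * A)%type in_fibre_product
    in_fibre_product_subring.

Definition fibre_product : Type := {w : k * A | in_fibre_product w}.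
HB.instance Definition _ := SubChoice.on fibre_product.
HB.instance Definition _ := [SubChoice_isSubComNzRing of fibre_product by <:].

Definition fibre_fst : fibre_product -> k := fst \o val.
HB.instance Definition _ := GRing.RMorphism.on fibre_fst.
Definition fibre_snd : fibre_product -> A := snd \o val.
HB.instance Definition _ := GRing.RMorphism.on fibre_snd.

End FibreProduct.

(** A lift of g along pi is a section of the projection from the fibre product
    to k, whose kernel is that of pi. *)
Lemma ring_lift_sqzero (k : fieldType) (A B : comNzRingType)
    (pi : {rmorphism A -> B}) (g : k -> B) :
    (forall b, exists a, pi a = b) ->
    (forall a b, pi a = 0 -> pi b = 0 -> a * b = 0) ->
    (forall p, p \in [pchar k] -> p%:R = 0 :> A) ->
    zmod_morphism g -> GRing.monoid_morphism g ->
  exists f : k -> A,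
    [/\ zmod_morphism f, GRing.monoid_morphism f & forall x, pi (f x) = g x].
Proof.
move=> pi_surj sqz charA gB gM.
pose gr : {rmorphism k -> B} := HB.pack g
  (GRing.isZmodMorphism.Build k B g gB) (GRing.isMonoidMorphism.Build k B g gM).
pose C : comNzRingType := fibre_product pi gr.
have fibreP (w : C) : pi (fibre_snd w) = g (fibre_fst w) by apply/eqP/(valP w).
have g0 : g 0 = 0 by rewrite -(subrr 0) gB subrr.
have [||p pk|s [sB sM sK]] := @sqzero_section k C (@fibre_fst k A B pi gr).
- move=> x; have [a ax] := pi_surj (g x).
  have xa : in_fibre_product pi gr (x, a) by apply/eqP.
  by exists (Sub (x, a) xa).
- move=> u v u0 v0; apply: val_inj; rewrite rmorphM rmorph0.
  apply: injective_projections => /=; first by rewrite [_.1]u0 mul0r.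
  by apply: sqz; rewrite [LHS]fibreP ?u0 ?v0.
- apply: val_inj; rewrite rmorph_nat rmorph0.
  apply: injective_projections; rewrite rmorph_nat /= ?charA //.
  exact: pcharf0 pk.
exists (@fibre_snd k A B pi gr \o s); split=> [x y||x] /=.
- by rewrite sB rmorphB.
- by split=> [|x y] /=; rewrite sM ?rmorph1 ?rmorphM.
- by rewrite fibreP sK.
Qed.

(** * Lifting multiplicative maps along a square-zero extension *)

Section MultiplicativeLift.

Variables (k : fieldType) (A B : comNzRingType) (pi : {rmorphism A -> B}).
Variables (p : nat) (g : k -> B).
Hypothesis pi_surj : forall b, exists a, pi a = b.
Hypothesis pi_sqz : forall a b, pi a = 0 -> pi b = 0 -> a * b = 0.
Hypothesis pk : p \in [pchar k].
Hypothesis pi_p : forall a, pi a = 0 -> p%:R * a = 0.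
Hypotheses (g0 : g 0 = 0) (gM : GRing.monoid_morphism g).

Let over (w : k * A) : Prop := pi w.2 = g w.1.

Let over_lift x : exists a, over (x, a).
Proof. by have [a ax] := pi_surj (g x); exists a. Qed.

Let over1 : over 1.
Proof. by rewrite /over /= rmorph1 gM. Qed.

Let overM u v : over u -> over v -> over (u * v).
Proof. by rewrite /over /= rmorphM gM => -> ->. Qed.

Let overX u n : over u -> over (u ^+ n).
Proof.
by move=> uP; elim: n => [|n IH]; [exact: over1 | rewrite exprS; exact: overM].
Qed.

Let over_expp u v : over u -> over v -> (u ^+ p).1 = (v ^+ p).1 ->
  u ^+ p = v ^+ p.
Proof.
move=> uP vP uv; apply: injective_projections => //.
have e : u.1 = v.1.
  move: uv; rewrite ![(_ ^+ p).1](rmorphXn fst) -!(pFrobenius_autE pk).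
  exact: fmorph_inj.
rewrite ![(_ ^+ p).2](rmorphXn snd); apply: (sqzero_expp pi_sqz pi_p).
by rewrite uP vP e.
Qed.

(** The graphs of the multiplicative lifts of g to a submonoid of k that
    contains the p-th powers. *)
Definition multiplicative_partial_section (G : set (k * A)) : Prop :=
  [/\ forall u, G u -> over u,
      forall u v, G u -> G v -> u.1 = v.1 -> u = v,
      forall u, over u -> G (u ^+ p) &
      forall u v, G u -> G v -> G (u * v)].

Lemma multiplicative_partial_section_bigcup (F : set (set (k * A))) :
  F !=set0 -> F `<=` multiplicative_partial_section -> total_on F subset ->
  multiplicative_partial_section (\bigcup_(X in F) X).
Proof.
move=> [X0 FX0] FP Ftot.
split=> [u [X FX Xu]|u v Uu Uv|u uP|u v Uu Uv].
- by case: (FP X FX) => Xo _ _ _; apply: Xo.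
- have [X [FX Xu Xv]] := chain_bigcup2 Ftot Uu Uv.
  by case: (FP X FX) => _ XI _ _; apply: XI.
- by exists X0 => //; case: (FP X0 FX0) => _ _ XF _; apply: XF.
- have [X [FX Xu Xv]] := chain_bigcup2 Ftot Uu Uv.
  by exists X => //; case: (FP X FX) => _ _ _ XM; apply: XM.
Qed.

Lemma multiplicative_partial_section_expp :
  multiplicative_partial_section [set u | exists2 w, over w & u = w ^+ p].
Proof.
split=> [_ [u uP ->]|_ _ [u uP ->] [v vP ->]|u uP|_ _ [u uP ->] [v vP ->]].
- exact: overX.
- exact: over_expp.
- by exists u.
- by exists (u * v); [exact: overM | rewrite exprMn].
Qed.

(** A maximal partial lift G is defined everywhere.  Its domain D is stable
    under inversion, because the inverse of u is u ^ (p - 1) times the p-th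
    power of 1 / u.  If x is not in D, then x ^ d is in D only for p dividing
    d, by Bezout; the relations between x and D thus follow from the membership
    of x ^ p, and any lift of x has the right p-th power. *)
Lemma multiplicative_lift_sqzero : exists f : k -> A,
  [/\ f 0 = 0, GRing.monoid_morphism f & forall x, pi (f x) = g x].
Proof.
have [G [[Gover Ginj Gexp GM] Gmax]] := Zorn_above
  multiplicative_partial_section_expp multiplicative_partial_section_bigcup.
have p_pr : prime p by case/andP: pk.
have p0 : (0 < p)%N := prime_gt0 p_pr.
have G1 : G 1 by rewrite -(expr1n _ p); exact: Gexp.
have G0 : G 0.
  have := Gexp 0; rewrite expr0n -[p == 0]negbK -lt0n p0; apply.
  by rewrite /over /= rmorph0 g0.
have GX u n : G u -> G (u ^+ n).
  by move=> Gu; elim: n => [|n IH]; rewrite ?expr0 // exprS; apply: GM.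
have GV u : G u -> u.1 != 0 -> exists2 v, G v & u * v = 1.
  move=> Gu u0; have [a aP] := over_lift u.1^-1.
  have Gv : G (u ^+ p.-1 * (u.1^-1, a) ^+ p).
    by apply: GM; [exact: GX | exact: Gexp].
  exists (u ^+ p.-1 * (u.1^-1, a) ^+ p) => //.
  apply: Ginj => //; first exact: GM.
  rewrite mulrA -exprS prednK // -exprMn [LHS](rmorphXn fst) /=.
  by rewrite divff ?expr1n.
have Gdom x : exists u, G u /\ u.1 = x.
  apply: contrapT => xG; have [a aP] := over_lift x; pose w : k * A := (x, a).
  have x0 : x != 0 by apply: contra_notN xG => /eqP ->; exists 0.
  have pd d z : G z -> z.1 = x ^+ d -> (p %| d)%N.
    move=> Gz zx; apply: contra_notT xG; rewrite -prime_coprime // => cpd.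
    have d0 : (0 < d)%N.
      by case: d cpd {zx} => //; rewrite /coprime gcdn0 => /eqP p1;
         move: p_pr; rewrite p1.
    have [i j ij _] := egcdnP p d0.
    have [v Gv wv] : exists2 v, G v & w ^+ (j * p) * v = 1.
      by apply: GV; rewrite ?[_.1](rmorphXn fst) ?expf_neq0 // mulnC exprM;
         apply/GX/Gexp.
    exists (z ^+ i * v); split; first by apply: GM => //; apply: GX.
    move/(congr1 fst): wv; rewrite /= ![(_ ^+ _).1](rmorphXn fst) /= zx -exprM.
    rewrite [(d * i)%N]mulnC ij gcdnC (eqP cpd) exprD expr1 => wv.
    by rewrite mulrAC wv mul1r.
  (* H is the graph G with (x, a) adjoined. *)
  pose H := [set u | exists v j, G v /\ u = v * w ^+ j].
  have Hw : H w by exists 1, 1; rewrite mul1r.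
  suff [GH PH] : G `<=` H /\ multiplicative_partial_section H.
    by case: xG; exists w; split=> //; apply: (Gmax H).
  have GH : G `<=` H by move=> u Gu; exists u, 0; rewrite mulr1.
  split=> //; split=> [_ [v [j [Gv ->]]]||u uP|].
  - by apply: overM; [exact: Gover | exact: overX].
  - suff le_inj u v i j : (i <= j)%N -> G u -> G v ->
        (u * w ^+ i).1 = (v * w ^+ j).1 -> u * w ^+ i = v * w ^+ j.
      move=> _ _ [u [i [Gu ->]]] [v [j [Gv ->]]] uv.
      have [ij|/ltnW ji] := leqP i j; first exact: le_inj.
      by apply/esym/le_inj.
    move=> ij Gu Gv; rewrite -(subnK ij) addnC exprD.
    rewrite mulrCA [_ * (v * _)]mulrC /= !(rmorphXn fst) /=.
    move/(mulIf (expf_neq0 i x0)) => uv; congr (_ * _).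
    have [v0|v0] := eqVneq v.1 0.
      rewrite (Ginj v 0) // mul0r; apply: Ginj => //.
      by rewrite uv v0 mul0r.
    have [v' Gv' vv'] := GV _ Gv v0.
    have /pd /dvdnP[|q dq] : (u * v').1 = x ^+ (j - i).
    + by move/(congr1 fst): vv' => /= vv'; rewrite /= uv mulrAC vv' mul1r.
    + exact: GM.
    apply: Ginj => //.
      by apply: GM => //; rewrite dq exprM; apply/Gexp/overX.
    by rewrite uv /= (rmorphXn fst).
  - by apply: GH; apply: Gexp.
  - move=> _ _ [u [i [Gu ->]]] [v [j [Gv ->]]].
    by exists (u * v), (i + j)%N; split; [exact: GM | rewrite mulrACA exprD].
have Gdom' x : exists a, G (x, a) by have [[y a] [Gu <-]] := Gdom x; exists a.
have [f fP] := choice Gdom'.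
have fE u : G u -> f u.1 = u.2.
  by move=> Gu; rewrite -(Ginj _ _ (fP u.1) Gu).
exists f; split=> [|| x]; last exact: (Gover _ (fP x)).
  exact: (fE 0).
split=> [|x y]; first exact: (fE 1).
exact: (fE _ (GM _ _ (fP x) (fP y))).
Qed.

End MultiplicativeLift.

(** * Lifting through the tower of quotients by powers of an ideal *)

Section AdicTower.

Variables (R : comNzRingType) (M : idealr R).

Lemma adic_proj_eq n (a b : R) :
  adic_proj M n a = adic_proj M n b <-> a - b \in ideal_powS M n.
Proof.
rewrite Quotient.idealrBE; split=> [ab|/eqP//].
by apply/eqP; exact: ab.
Qed.

Lemma adic_proj_surj n (x : adic_quot M n) : exists a, adic_proj M n a = x.
Proof. by exists (repr (x : {ideal_quot (ideal_powS M n)})); apply: reprK. Qed.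

Fact adic_transition_zmod_morphism n :
  zmod_morphism (@adic_transition R M n).
Proof.
move=> x y; have [a <-] := adic_proj_surj x; have [b <-] := adic_proj_surj y.
by rewrite -rmorphB !adic_transitionE rmorphB.
Qed.

Fact adic_transition_monoid_morphism n :
  GRing.monoid_morphism (@adic_transition R M n).
Proof.
split=> [|x y].
  by rewrite -(rmorph1 (adic_proj M n.+1)) adic_transitionE rmorph1.
have [a <-] := adic_proj_surj x; have [b <-] := adic_proj_surj y.
by rewrite -rmorphM !adic_transitionE rmorphM.
Qed.

HB.instance Definition _ n := GRing.isZmodMorphism.Build _ _
  (@adic_transition R M n) (@adic_transition_zmod_morphism n).
HB.instance Definition _ n := GRing.isMonoidMorphism.Build _ _
  (@adic_transition R M n) (@adic_transition_monoid_morphism n).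

Lemma adic_transition_surj n (x : adic_quot M n) :
  exists y, adic_transition y = x.
Proof.
by have [a <-] := adic_proj_surj x; exists (adic_proj M n.+1 a);
   rewrite adic_transitionE.
Qed.

Lemma ideal_powSM n a b :
  a \in M -> b \in ideal_powS M n -> a * b \in ideal_powS M n.+1.
Proof.
move=> aM bM; apply/asboolP; exists [:: (a, b)]; rewrite big_seq1; split=> //.
by move=> u; rewrite inE => /eqP ->.
Qed.

Lemma ideal_powS_sub n : {subset ideal_powS M n <= M}.
Proof. by case: n => // n; apply: ideal_mulSl. Qed.

Lemma adic_transition_ker n (x : adic_quot M n.+1) : adic_transition x = 0 ->
  exists2 a, adic_proj M n.+1 a = x & a \in ideal_powS M n.
Proof.
have [a <-] := adic_proj_surj x; rewrite adic_transitionE => a0.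
by exists a => //; rewrite -[a]subr0 -adic_proj_eq a0 rmorph0.
Qed.

Lemma adic_transition_ker_mul n a (x : adic_quot M n.+1) :
  a \in M -> adic_transition x = 0 -> adic_proj M n.+1 a * x = 0.
Proof.
move=> aM /adic_transition_ker[b <- bM].
rewrite -rmorphM -(rmorph0 (adic_proj M n.+1)) adic_proj_eq subr0.
exact: ideal_powSM.
Qed.

Lemma adic_transition_sqz n (x y : adic_quot M n.+1) :
  adic_transition x = 0 -> adic_transition y = 0 -> x * y = 0.
Proof.
move=> /adic_transition_ker[a <- aM]; apply: adic_transition_ker_mul.
exact: ideal_powS_sub aM.
Qed.

Hypothesis M_complete : adically_complete M.

Lemma adic_separated a b :
  (forall n, adic_proj M n a = adic_proj M n b) -> a = b.
Proof.
move=> ab; apply: (bij_inj M_complete); apply: eq_exist.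
by apply: functional_extensionality_dep => n; apply: ab.
Qed.

(** P stands for the structure to be lifted at each stage, such as being a ring
    map.  The maps chosen one after the other are compatible, and completeness
    turns them into a single map to R. *)
Lemma lift_through_adic_tower (T : Type)
    (P : forall n, (T -> adic_quot M n) -> Prop) (g0 : T -> adic_quot M 0) :
    P 0 g0 ->
    (forall n g, P n g -> exists2 f, P n.+1 f &
       forall x, adic_transition (f x) = g x) ->
  exists2 s : T -> R, forall n, P n (adic_proj M n \o s) &
    forall x, adic_proj M 0 (s x) = g0 x.
Proof.
move=> P0 PS.
pose step n (g : {g | P n g}) : {f | P n.+1 f} :=
  let: exist2 f Pf _ := cid2 (PS n _ (svalP g)) in exist _ f Pf.
pose t := fix t n : {g | P n g} :=
  if n is n'.+1 then step n' (t n') else exist _ g0 P0.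
have tE n x : adic_transition (sval (t n.+1) x) = sval (t n) x.
  by rewrite /= /step; case: cid2 => f Pf /=.
have [l _ lK] := M_complete.
pose s x := l (exist (@adic_compatible R M) (fun n => sval (t n) x) (tE ^~ x)).
have sE n x : adic_proj M n (s x) = sval (t n) x.
  by have /(congr1 sval)/(congr1 (fun h => h n)) := lK
    (exist (@adic_compatible R M) (fun n => sval (t n) x) (tE ^~ x)).
exists s => [n|x]; last exact: sE.
have -> : adic_proj M n \o s = sval (t n) by apply/funext => x; apply: sE.
exact: svalP.
Qed.

End AdicTower.

(** * Splittings of the residue map *)

Section ResidueLift.

Variables (R : comNzRingType) (M : maximal_idealr R).
Local Notation k := (residue_field M).

Lemma residue_map_eq (a b : R) :
  residue_map M a = residue_map M b <-> a - b \in M.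
Proof.
rewrite Quotient.idealrBE; split=> [ab|/eqP//].
by apply/eqP; exact: ab.
Qed.

Lemma residue_map_surj (x : k) : exists a, residue_map M a = x.
Proof. by exists (repr (x : {ideal_quot M})); apply: reprK. Qed.

(** The residue field and [adic_quot M 0] are both the quotient of R by M, but
    as different types; this is the isomorphism between them. *)
Definition residue_to_adic0 (x : k) : adic_quot M 0 :=
  adic_proj M 0 (repr (x : {ideal_quot M})).

Lemma residue_to_adic0E a :
  residue_to_adic0 (residue_map M a) = adic_proj M 0 a.
Proof.
by apply/adic_proj_eq/residue_map_eq; apply: reprK.
Qed.

Lemma residue_to_adic0_zmod_morphism : zmod_morphism residue_to_adic0.
Proof.
move=> x y; have [a <-] := residue_map_surj x.
have [b <-] := residue_map_surj y.
by rewrite -rmorphB !residue_to_adic0E rmorphB.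
Qed.

Lemma residue_to_adic0_monoid_morphism :
  GRing.monoid_morphism residue_to_adic0.
Proof.
split=> [|x y].
  by rewrite -(rmorph1 (residue_map M)) residue_to_adic0E rmorph1.
have [a <-] := residue_map_surj x; have [b <-] := residue_map_surj y.
by rewrite -rmorphM !residue_to_adic0E rmorphM.
Qed.

Lemma residue_map_section (s : k -> R) :
  (forall x, adic_proj M 0 (s x) = residue_to_adic0 x) ->
  cancel s (residue_map M).
Proof.
move=> sE x; have [a ax] := residue_map_surj x.
by rewrite -[RHS]ax; apply/residue_map_eq/(@adic_proj_eq R M 0);
   rewrite sE -ax residue_to_adic0E.
Qed.

Hypothesis M_complete : adically_complete M.

Lemma ring_section_exists :
    (forall p, p \in [pchar k] -> p%:R = 0 :> R) ->
  exists g : {rmorphism k -> R}, cancel g (residue_map M).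
Proof.
move=> charR.
have [||s sP sE] := @lift_through_adic_tower R M M_complete k
    (fun n g => zmod_morphism g /\ GRing.monoid_morphism g) residue_to_adic0.
- by split; [exact: residue_to_adic0_zmod_morphism
            |exact: residue_to_adic0_monoid_morphism].
- move=> n g [gB gM].
  have [|||f [fB fM fg]] := @ring_lift_sqzero k _ _ (@adic_transition R M n) g
      _ _ _ gB gM.
  + exact: adic_transition_surj.
  + exact: adic_transition_sqz.
  + move=> p /charR p0.
    by rewrite -(rmorph_nat (adic_proj M n.+1)) p0 rmorph0.
  + by exists f.
have sB : zmod_morphism s.
  move=> x y; apply: (adic_separated M_complete) => n.
  by rewrite rmorphB; apply: (sP n).1.
have sM : GRing.monoid_morphism s.
  split=> [|x y]; apply: (adic_separated M_complete) => n.
    by rewrite rmorph1; apply: (sP n).2.1.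
  by rewrite rmorphM; apply: (sP n).2.2.
pose g : {rmorphism k -> R} := HB.pack s
  (GRing.isZmodMorphism.Build k R s sB) (GRing.isMonoidMorphism.Build k R s sM).
exists g; exact: residue_map_section.
Qed.

(** Here p is only known to vanish in k, that is, to lie in M; this suffices to
    kill the kernels M ^ (n + 1) / M ^ (n + 2). *)
Lemma multiplicative_section_exists p : p \in [pchar k] ->
  exists2 s : k -> R, GRing.monoid_morphism s & cancel s (residue_map M).
Proof.
move=> pk.
have pM : p%:R \in M.
  rewrite -[p%:R]subr0; apply/residue_map_eq.
  by rewrite rmorph0 rmorph_nat pcharf0.
have [||s sP sE] := @lift_through_adic_tower R M M_complete k
    (fun n g => g 0 = 0 /\ GRing.monoid_morphism g) residue_to_adic0.
- split; last exact: residue_to_adic0_monoid_morphism.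
  by rewrite -(rmorph0 (residue_map M)) residue_to_adic0E rmorph0.
- move=> n g [g0 gM].
  have [|||f [f0 fM fg]] := @multiplicative_lift_sqzero k _ _
      (@adic_transition R M n) p g _ _ pk _ g0 gM.
  + exact: adic_transition_surj.
  + exact: adic_transition_sqz.
  + move=> x; rewrite -(rmorph_nat (adic_proj M n.+1)).
    exact: adic_transition_ker_mul.
  + by exists f.
exists s; last exact: residue_map_section.
split=> [|x y]; apply: (adic_separated M_complete) => n.
  by rewrite rmorph1; apply: (sP n).2.1.
by rewrite rmorphM; apply: (sP n).2.2.
Qed.

End ResidueLift.

Lemma ring_char_dvd (R S : nzRingType) (f : {rmorphism R -> S}) :
  (ring_char S %| ring_char R)%N.
Proof.
apply/(ring_charP S (ring_char R)); rewrite -(rmorph_int f).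
by rewrite (ring_charP R _).2 ?rmorph0 // dvdzz.
Qed.

Lemma ring_char_pchar (k : fieldType) :
  ring_char k != 0 -> exists p, p \in [pchar k].
Proof.
rewrite -lt0n => c0; apply: (GRing.natf0_pchar c0).
by rewrite pmulrn; apply/eqP/(ring_charP k); apply: dvdzz.
Qed.

Theorem theorem1p1 (R : comUnitRingType) (M : maximal_idealr R)
    (R_local : local_ring M) (R_complete : adically_complete M) :
  [<-> has_coefficient_field M;
       exists g : {rmorphism residue_field M -> R}, cancel g (residue_map M);
       ring_char R = ring_char (residue_field M)]
  /\ (ring_char R <> ring_char (residue_field M) ->
      exists s : {multiplicative unit_group (residue_field M) -> unit_group R},
        cancel s (unit_group_map (residue_map M))).
Proof.
split.
  tfae.
  - move=> [K [f [h fK hK]]].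
    have fhK x : residue_map M (f (h x)) = x by apply: hK.
    have hB : zmod_morphism h.
      by move=> x y; apply: (can_inj fK); rewrite /= !rmorphB /= !fhK.
    have hM : GRing.monoid_morphism h.
      split=> [|x y]; apply: (can_inj fK); first by rewrite /= fhK !rmorph1.
      by rewrite /= !rmorphM /= !fhK.
    pose hr : {rmorphism residue_field M -> K} := HB.pack h
      (GRing.isZmodMorphism.Build _ _ h hB)
      (GRing.isMonoidMorphism.Build _ _ h hM).
    by exists (f \o hr) => x; apply: hK.
  - move=> [g _]; apply/eqP; rewrite eqn_dvd (ring_char_dvd g).
    exact: ring_char_dvd (residue_map M).
  - move=> charE; have [|g gK] := ring_section_exists R_complete.
      move=> p /pcharf0 p0; rewrite pmulrn; apply/(ring_charP R); rewrite charE.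
      by apply/(ring_charP (residue_field M)); rewrite -pmulrn.
    exists (residue_field M), g; exists id => x //=; exact: gK.
move=> charN; have [|p pk] := @ring_char_pchar (residue_field M).
  apply: contra_notN charN => /eqP k0.
  have := ring_char_dvd (residue_map M).
  by rewrite k0 dvd0n => /eqP.
have [s sM sK] := multiplicative_section_exists R_complete pk.
have sU (x : unit_group (residue_field M)) : s (val x) \is a GRing.unit.
  apply/unitrP; exists (s (val x)^-1).
  by rewrite -!sM mulVr ?mulrV ?(valP x) ?sM.
pose t (x : unit_group (residue_field M)) : unit_group R :=
  Sub (s (val x)) (sU x).
have tM : {morph t : x y / (x * y)%g}.
  by move=> x y; apply: val_inj; apply: sM.2.
pose tr : {multiplicative unit_group (residue_field M) -> unit_group R} :=
  HB.pack t (isMultiplicative.Build _ _ t tM).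
by exists tr => x; apply: val_inj; apply: sK.
Qed.
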